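(* Let $u$ be the solution of the semilinear parabolic problem $u'(t)+Au(t)=f(t,u(t))$, $t\in J:=(0,T]$, $u(0)=u^0$, where $f(t,\cdot)$ satisfies the local Lipschitz condition $$|f(t,v)-f(t,w)|\le\gamma(t)\|v-w\|\qquad\forall v,w\in\mathcal B_{u(t)},\ t\in J,$$ with a smooth nonnegative function $\gamma:J\to\mathbb R$ and $\mathcal B_{u(t)}:=\{v\in V:\|v-u(t)\|\le1\}$. Let $U^n$, $n=2,3,\dots,N$, be the solution sequence of the variable step-size BDF2 scheme $$\bar\partial_B^2U^n+AU^n=f(t^n,U^n),\qquad n=2,3,\dots,N,$$ and let $U^0=u^0$; $U^1$ is a given starting approximation. Let $e^n=u(t^n)-U^n$. Then the following hold for $n=2,3,\dots,N$. (i) If $r_{\max}\le R$ with $1<R<R_1=(3+\sqrt{17})/2\approx3.561$, and if there exists a constant $c_1$ such that $k_{\max}$ satisfies $c_R\gamma^2k_{\max}\le c_1<1$, where $c_R>\max\big\{\frac{2+2R}{2+R},\frac{2+2R}{2+3R-R^2}\big\}$, then $$\|e\|^2_{l^2(t^2,t^n;V)}+\|e\|^2_{l^\infty(t^2,t^n;V)}\le C\Big(k_{\max}^4t^n+\frac1{k_1}|e^1|^2+\|e^1\|^2\Big),$$ where $C$ depends only on $C_2$, $t^n$, $c_4$ and $c_R$, with $C_2=\frac{c_R}{1-c_1}\exp\big(\frac{c_R}{1-c_1}\sum_{j=2}^n\gamma^2(t^j)k_j\big)$. (ii) If we further restrict $r_{\max}\le R$ with $1<R<R_0=\sqrt2+1\approx2.414$,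 and if there exists a constant $c_1$ such that $k_{\max}$ satisfies $(4+2\sqrt2)\gamma^2k_{\max}\le c_1<1$, then $$\|e\|^2_{l^2(t^2,t^n;H,H)}+\|e\|^2_{l^\infty(t^2,t^n;V)}\le C\Big(k_{\max}^4t^n+\frac{k_2}{k_1^2}|e^1|^2+\|e^1\|^2\Big),$$ where $C$ depends only on $C_1$, $t^n$, $c_4$ and $r_2$, with $C_1=\frac{4+2\sqrt2}{1-c_1}\exp\big(\frac{4+2\sqrt2}{1-c_1}\sum_{j=2}^n\gamma^2(t^j)k_j\big)$. (iii) Let $r_{\max}\le R$ with $1<R<R_0=\sqrt2+1\approx2.414$, and set $c_3=\frac{(1+R)^2}{1+2R-R^2}$. If there exist constants $c_1$ and $c_2$ such that $k_{\max}$ satisfies $(4+2\sqrt2)\gamma^2k_{\max}\le c_1<1$ and $2c_3\gamma^2k_{\max}\le c_2<1$, then $$|e|^2_{l^\infty(t^2,t^n;H)}+\|e\|^2_{l^2(t^2,t^n;V)}\le C\Big(|e^1|^2+k_{\max}\|e^1\|^2+\frac{k_{\max}k_2}{k_1^2}|e^1|^2+k_{\max}^4\Big),$$ where $C$ depends only on $\gamma$, $c_i$ ($i=1,2,3,4$), $R$, $t^n$ and $\Phi_n:=\sum_{j=2}^{n-2}[r_j-r_{j+2}]_+$, $[x]_+:=\frac{|x|+x}2$.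
   Context: Let $(H,(\cdot,\cdot))$ be a Hilbert space with norm $|\cdot|$, and $A:D(A)\to H$ a positive definite, self-adjoint, linear operator with domain $D(A)$ dense in $H$. Let $V=D(A^{1/2})$ with norm $\|v\|=|A^{1/2}v|=(Av,v)^{1/2}$. Without argument, $\gamma:=\max_{t\in J}\gamma(t)$. Partition: $N\ge2$, $0=t^0<t^1<\dots<t^N=T$, $k_n=t^n-t^{n-1}$ for $n\ge1$, $r_n=k_n/k_{n-1}$ and $s_n=r_n/(1+r_n)=k_n/(k_n+k_{n-1})$ for $n\ge2$; $k_{\max}=\max_{2\le n\le N}k_n$, $r_{\max}=\max_{2\le n\le N}r_n$. Difference operators: $\bar\partial U^n=(U^n-U^{n-1})/k_n$ and $\bar\partial_B^2U^n=(1+s_n)\bar\partial U^n-s_n\bar\partial U^{n-1}$. The $U^n\in D(A)$ are nodal approximations to $u(t^n)$. Consistency error: $d_2^n=\bar\partial_B^2u(t^n)+Au(t^n)-f(t^n,u(t^n))=\bar\partial_B^2u(t^n)-u'(t^n)$, $n\ge2$. The solution $u$ is regular enough that $|d_2^n|\le c_4k_n^2$ for $n\ge2$, where the constant $c_4$ depends only on some derivatives of the exact solution $u$. Norms: $|e|_{l^\infty(t^{n_1},t^{n_2};H)}=\max_{n_1\le j\le n_2}|e^j|$, $\|e\|_{l^\infty(t^{n_1},t^{n_2};V)}=\max_{n_1\le j\le n_2}\|e^j\|$, $\|e\|_{l^2(t^{n_1},t^{n_2};V)}=\big(\sum_{j=n_1}^{n_2}k_j\|e^j\|^2\big)^{1/2}$,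 and $\|e\|_{l^2(t^{n_1},t^{n_2};H,H)}=\big(\sum_{j=n_1}^{n_2-1}k_js_j|\bar\partial e^j|^2\big)^{1/2}$. Empty sums are $0$.
   Formalization: The formal theorem additionally assumes that U^n lies in the ball B_{u(t^n)} for n=2,…,N; without this f is uncontrolled at U^n, and the stated bounds fail (e.g. H=R, A=1, u=0, f=0 on the ball but large at U^2=M). *)

(* Defs.v *)
From HB Require Import structures.
From mathcomp Require Export all_boot all_order all_algebra.
From mathcomp Require Export all_classical all_reals all_analysis.
Export Order.TTheory GRing.Theory Num.Theory.
Export numFieldNormedType.Exports.

#[export] Set Implicit Arguments.
#[export] Unset Strict Implicit.
#[export] Unset Printing Implicit Defensive.

Global Open Scope classical_set_scope.
Global Open Scope ring_scope.

Section Operators.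
Variables (R : realType) (H : completeNormedModType R).

(* Together with the completeness of H, this makes (H, dot) a real Hilbert
   space. *)
Definition hilbert_norm (dot : {dot H for idfun}) : Prop :=
  forall x, dot x x = `|x| ^+ 2.

(* A possibly unbounded operator: only the values of op_fun on op_dom matter. *)
Record operator := Operator { op_dom : set H ; op_fun :> H -> H }.

Definition linear_operator (A : operator) : Prop :=
  [/\ op_dom A 0,
      forall (a : R) x y,
        op_dom A x -> op_dom A y -> op_dom A (a *: x + y) &
      forall (a : R) x y,
        op_dom A x -> op_dom A y -> A (a *: x + y) = a *: A x + A y].

(* The last clause says that A and its adjoint have the same graph, i.e.
   A^* = A including equality of domains; it is stronger than symmetry. *)
Definition self_adjoint (dot : {dot H for idfun}) (A : operator) : Prop :=
  [/\ linear_operator A,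
      dense (op_dom A) &
      forall y z, (forall x, op_dom A x -> dot (A x) y = dot x z) <->
                  (op_dom A y /\ A y = z)].

Definition positive_definite (dot : {dot H for idfun}) (A : operator) : Prop :=
  forall x, op_dom A x -> x != 0 -> 0 < dot (A x) x.

(* B = A^{1/2}: the (unique) nonnegative self-adjoint B with B o B = A, where
   the composition has its natural domain {x in D(B) | B x in D(B)}. *)
Definition is_sqrt_operator (dot : {dot H for idfun}) (A B : operator) : Prop :=
  [/\ self_adjoint dot B,
      forall x, op_dom B x -> 0 <= dot (B x) x,
      forall x, op_dom A x <-> (op_dom B x /\ op_dom B (B x)) &
      forall x, op_dom A x -> A x = B (B x)].

(* ||v|| = |A^{1/2} v|, for v in V = op_dom B. *)
Definition normV (B : operator) (v : H) : R := `|B v|.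

(* The ball of radius 1 in V around w. *)
Definition tube (B : operator) (w : H) : set H :=
  [set v | op_dom B v /\ normV B (v - w) <= 1].

End Operators.

Section Problem.
Variable R : realType.

(* Difference quotients use only points of E, so the derivative is one-sided at
   an end point of E. *)
Definition has_derivative_in (W : normedModType R) (E : set R) (g : R -> W)
    (x : R) (l : W) : Prop :=
  (fun h : R => h^-1 *: (g (x + h) - g x))
    @ (within [set h | E (x + h)] (0 : R)^') --> l.

(* C^oo on E; D j is the j-th derivative. *)
Definition smooth_on (E : set R) (g : R -> R) : Prop :=
  exists2 D : nat -> R -> R^o,
    (forall x, E x -> D 0%N x = g x) &
    (forall j x, E x -> has_derivative_in E (D j) x (D j.+1 x)).

(* J = (0, T] *)
Definition Jint (T : R) : set R := [set x | 0 < x <= T].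

(* max over J of gamma; being stated as a supremum, it also makes sense when
   gamma is bounded on the half-open interval J without attaining a maximum. *)
Definition gamma_max (T : R) (gamma : R -> R) : R := sup (gamma @` Jint T).

Record lipschitz_rate (T : R) (gamma : R -> R) : Prop := {
  rate_smooth : smooth_on (Jint T) gamma ;
  rate_ge0 : forall x, Jint T x -> 0 <= gamma x ;
  rate_bounded : has_ubound (gamma @` Jint T) }.

Variable H : completeNormedModType R.

Definition locally_lipschitz (B : operator H) (T : R) (u : R -> H)
    (gamma : R -> R) (f : R -> H -> H) : Prop :=
  forall x, Jint T x -> forall v w, tube B (u x) v -> tube B (u x) w ->
    `|f x v - f x w| <= gamma x * normV B (v - w).

(* u' + A u = f(., u) on J, u(0) = u0 *)
Record parabolic_solution (A : operator H) (T : R) (f : R -> H -> H) (u0 : H)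
    (u : R -> H) : Prop := {
  sol_continuous : {within `[0, T], continuous u} ;
  sol_init : u 0 = u0 ;
  sol_dom : forall x, Jint T x -> op_dom A (u x) ;
  sol_eq : forall x, Jint T x ->
    has_derivative_in (Jint T) u x (f x (u x) - A (u x)) }.

End Problem.

Section Scheme.
Variable R : realType.
Variable t : nat -> R.

Definition partition_of (T : R) (N : nat) : Prop :=
  [/\ t 0%N = 0, t N = T & forall n, (n < N)%N -> t n < t n.+1].

Definition kstep (n : nat) : R := t n - t n.-1.
Definition rstep (n : nat) : R := kstep n / kstep n.-1.
Definition sstep (n : nat) : R := rstep n / (1 + rstep n).

(* The maxima below are over positive (resp. nonnegative) numbers, so the base
   value 0 is harmless. *)
Definition kmax (N : nat) : R := \big[Num.max/0]_(2 <= n < N.+1) kstep n.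
Definition rmax (N : nat) : R := \big[Num.max/0]_(2 <= n < N.+1) rstep n.

Definition pospart (x : R) : R := (`|x| + x) / 2.

Definition Phi (n : nat) : R :=
  \sum_(2 <= j < n.-1) pospart (rstep j - rstep j.+2).

Variable H : completeNormedModType R.

Definition dbar (U : nat -> H) (n : nat) : H :=
  (kstep n)^-1 *: (U n - U n.-1).

Definition dbarB2 (U : nat -> H) (n : nat) : H :=
  (1 + sstep n) *: dbar U n - sstep n *: dbar U n.-1.

Record bdf2_solution (A : operator H) (N : nat) (f : R -> H -> H) (u0 : H)
    (U : nat -> H) : Prop := {
  bdf2_dom : forall n, (n <= N)%N -> op_dom A (U n) ;
  bdf2_init : U 0%N = u0 ;
  bdf2_eq : forall n, (2 <= n <= N)%N ->
    dbarB2 U n + A (U n) = f (t n) (U n) }.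

(* d_2^n *)
Definition consistency_error (A : operator H) (f : R -> H -> H) (u : R -> H)
    (n : nat) : H :=
  dbarB2 (fun j => u (t j)) n + A (u (t n)) - f (t n) (u (t n)).

(* Discrete norms over the levels n1, ..., n2. *)
Definition linfH (e : nat -> H) (n1 n2 : nat) : R :=
  \big[Num.max/0]_(n1 <= j < n2.+1) `|e j|.

Definition linfV (B : operator H) (e : nat -> H) (n1 n2 : nat) : R :=
  \big[Num.max/0]_(n1 <= j < n2.+1) normV B (e j).

Definition l2V (B : operator H) (e : nat -> H) (n1 n2 : nat) : R :=
  Num.sqrt (\sum_(n1 <= j < n2.+1) kstep j * normV B (e j) ^+ 2).

Definition l2HH (e : nat -> H) (n1 n2 : nat) : R :=
  Num.sqrt (\sum_(n1 <= j < n2) kstep j * sstep j * `|dbar e j| ^+ 2).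

(* a/(1-c1) exp(a/(1-c1) sum_{j=2}^n gamma^2(t^j) k_j) *)
Definition gronwall_const (a c1 : R) (gamma : R -> R) (n : nat) : R :=
  a / (1 - c1) *
  expR (a / (1 - c1) * \sum_(2 <= j < n.+1) gamma (t j) ^+ 2 * kstep j).

End Scheme.

(* Main.v *)
Require Import Defs.
From mathcomp Require Import ring lra zify.

(** Write [v^j] for the difference quotients of the error [e], and [b^j] for the
    right-hand side of its BDF2 equation.

    For (i) and (ii), test the equation with [e^n - e^(n-1)].  Young's inequality
    [2 (v^(n-1), v^n) <= 2 |v^n|^2 + |v^(n-1)|^2 / 2] leaves
    [||e^n||^2 + 2 (1 - beta) k_n |v^n|^2 <=
     ||e^(n-1)||^2 + (k_n s_n / 2) |v^(n-1)|^2 + k_n |b^n|^2 / (2 beta)],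
    so that [||e^n||^2 + 2 theta k_n |v^n|^2] obeys a discrete Gronwall inequality
    whenever [k_n s_n <= 4 theta k_(n-1)] and [theta <= 1 - beta].  In (i),
    [beta = 1 / c_R] and [theta = 1 - beta] work: adding the two lower bounds on
    [c_R] gives [R^2 <= 4 (1 - beta) (1 + R)].  In (ii), [beta = 1/2] and
    [theta = 9/20] leave a positive multiple of [sum k_j |v^j|^2].

    For (iii), test with [e^n].  The increments [Y_n = |e^n|^2 - |e^(n-1)|^2]
    satisfy [Y_n + k_n ||e^n||^2 / 2 <= rho_n Y_(n-1) + h_n] with
    [rho_n = r_n^2 / (1 + 2 r_n) <= R^2 / (1 + 2 R) < 1], and [h_n] involves
    [|e^(n-1) - e^(n-2)|^2], which is summable by the estimate behind (ii).  Since
    the recursion contracts, summing it costs only the factor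
    [1 / (1 - rho) <= c_3], so that no variation of the step ratios enters. *)

Section RealSequences.
Variable R : realType.
Implicit Types (F G x Y D h rho : nat -> R) (n m : nat).

Lemma discrete_gronwall F x G (c : R) n :
  c < 1 -> 0 <= F 1%N ->
  (forall j, (2 <= j <= n)%N -> 0 <= x j <= c) ->
  (forall j, (2 <= j <= n)%N -> 0 <= G j) ->
  (forall j, (2 <= j <= n)%N -> F j <= F j.-1 + x j * F j + G j) ->
  forall m, (1 <= m <= n)%N ->
    F m <= expR ((1 - c)^-1 * \sum_(2 <= j < m.+1) x j)
           * (F 1%N + \sum_(2 <= j < m.+1) G j).
Proof.
move=> c1 F1 xc G0 step; elim=> [//|m IH] mn.
have [->|m0] := eqVneq m 0%N.
  by rewrite !big_geq// mulr0 expR0 addr0 mul1r.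
have m2 : (2 <= m.+1 <= n)%N by lia.
have {}IH := IH ltac:(lia).
rewrite !(@big_nat_recr _ _ _ m.+1)/=; [|lia..].
have := step _ m2; rewrite /= => Fm.
have /andP[xm0 xmc] := xc _ m2; have Gm := G0 _ m2.
rewrite [(1 - c)^-1 * _]mulrDr expRD.
set X := expR (_ * \sum_(2 <= j < _) _) in IH *.
set S := F 1%N + \sum_(2 <= j < _) _ in IH *.
have X1 : 1 <= X.
  rewrite -expR0 ler_expR mulr_ge0 ?invr_ge0 ?subr_ge0 ?(ltW c1)//.
  rewrite big_nat; apply: sumr_ge0 => j jm.
  by have /andP[] := xc j ltac:(lia).
have S0 : 0 <= S.
  rewrite addr_ge0// big_nat; apply: sumr_ge0 => j jm; apply: G0; lia.
have q1 : 1 <= (1 - x m.+1) * expR ((1 - c)^-1 * x m.+1).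
  apply: (@le_trans _ _ ((1 - x m.+1) * (1 + (1 - c)^-1 * x m.+1))); last first.
    by rewrite ler_wpM2l ?expR_ge1Dx// subr_ge0; lra.
  have : 1 <= (1 - c)^-1 * (1 - x m.+1).
    by rewrite mulrC ler_pdivlMr ?mul1r; lra.
  have : 0 <= x m.+1 * ((1 - c)^-1 * (1 - x m.+1) - 1) ->
    1 <= (1 - x m.+1) * (1 + (1 - c)^-1 * x m.+1) by lra.
  by move=> + ge1; apply; rewrite mulr_ge0// subr_ge0.
rewrite addrA -/S -(@ler_pM2l _ (1 - x m.+1)) ?subr_gt0; last lra.
apply: (@le_trans _ _ (X * (S + G m.+1))).
  have : G m.+1 <= X * G m.+1 by rewrite ler_peMl.
  by rewrite mulrDr mulrBl mul1r; lra.
have : 0 <= X * (S + G m.+1).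
  by apply: mulr_ge0; [exact: (le_trans ler01 X1)|exact: addr_ge0].
move=> P0; apply: (le_trans (ler_peMl P0 q1)).
by rewrite le_eqVlt; apply/orP; left; apply/eqP; ring.
Qed.

Lemma contraction_sum Y h D rho (q : R) n :
  q < 1 -> 0 <= Y 1%N ->
  (forall j, (2 <= j <= n)%N -> 0 <= rho j <= q) ->
  (forall j, (2 <= j <= n)%N -> 0 <= h j) ->
  (forall j, (2 <= j <= n)%N -> 0 <= D j) ->
  (forall j, (2 <= j <= n)%N -> Y j + D j <= rho j * Y j.-1 + h j) ->
  forall m, (1 <= m <= n)%N ->
    \sum_(2 <= j < m.+1) Y j + \sum_(2 <= j < m.+1) D j
      <= (1 - q)^-1 * (Y 1%N + \sum_(2 <= j < m.+1) h j).
Proof.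
move=> q1 Y1 rhoq h0 D0 step m mn; set i := (1 - q)^-1.
have i1 : i * (1 - q) = 1 by rewrite mulVf//; lra.
have i0 : 0 < i by rewrite invr_gt0; lra.
(* A majorizes the positive part of Y m and pays for all later increments. *)
suff [A [A0 q0 YA]] : exists A : R, [/\ 0 <= A, (2 <= m)%N -> 0 <= q, Y m <= A &
    \sum_(2 <= j < m.+1) Y j + \sum_(2 <= j < m.+1) D j + (i - 1) * A
      <= i * (Y 1%N + \sum_(2 <= j < m.+1) h j)].
  have [->|m1] := eqVneq m 1%N.
    by move=> _; rewrite !big_geq// !addr0 mulr_ge0// ltW.
  have {}q0 := q0 ltac:(lia).
  have : 0 <= (i - 1) * A by rewrite mulr_ge0//; nra.
  by lra.
elim: m mn => [//|m IH] mn.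
have [->|m0] := eqVneq m 0%N.
  exists (Y 1%N); split => //; rewrite !big_geq//; lra.
have {IH} [A [A0 q0 YA SA]] := IH ltac:(lia).
have m2 : (2 <= m.+1 <= n)%N by lia.
rewrite !(@big_nat_recr _ _ _ m.+1)/=; [|lia..].
have := step _ m2; rewrite /= => Ym.
have /andP[r0 rq] := rhoq _ m2; have hm := h0 _ m2; have Dm := D0 _ m2.
exists (rho m.+1 * A + h m.+1); split.
- by rewrite addr_ge0// mulr_ge0.
- by move=> _; exact: (le_trans r0 rq).
- by apply: le_trans (_ : rho m.+1 * Y m + h m.+1 <= _); [lra|rewrite lerD2r ler_wpM2l].
set SY := \sum_(2 <= j < _) Y j in SA *.
set SD := \sum_(2 <= j < _) D j in SA *.
set Sh := \sum_(2 <= j < _) h j in SA *.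
have ineq : rho m.+1 * Y m <= rho m.+1 * A by rewrite ler_wpM2l.
have ineq2 : i * (rho m.+1 * A) <= (i * q) * A.
  by rewrite -mulrA ler_wpM2l ?ler_wpM2r// ltW.
nra.
Qed.

End RealSequences.

Section InnerProduct.
Variables (R : realType) (H : completeNormedModType R).
Variable dot : {dot H for idfun}.
Hypothesis dot_norm : hilbert_norm dot.
Implicit Types (x y z : H).

Lemma dotDl x y z : dot (x + y) z = dot x z + dot y z.
Proof. by rewrite linearDl. Qed.

Lemma dotBl x y z : dot (x - y) z = dot x z - dot y z.
Proof. by rewrite linearBl. Qed.

Lemma dotDr x y z : dot z (x + y) = dot z x + dot z y.
Proof. by rewrite linearDr. Qed.

Lemma dotZl (a : R) x y : dot (a *: x) y = a * dot x y.
Proof. by rewrite linearZl_LR. Qed.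

Lemma dotZr (a : R) x y : dot x (a *: y) = a * dot x y.
Proof. by rewrite linearZr_LR. Qed.

Lemma dotC x y : dot x y = dot y x.
Proof. by rewrite hermC /= expr0 mul1r. Qed.

Lemma sqr_normD x y : `|x + y| ^+ 2 = `|x| ^+ 2 + 2 * dot x y + `|y| ^+ 2.
Proof. by rewrite -!dot_norm dotDl !dotDr /= (dotC y x); ring. Qed.

Lemma sqr_normB x y : `|x - y| ^+ 2 = `|x| ^+ 2 - 2 * dot x y + `|y| ^+ 2.
Proof. by rewrite sqr_normD normrN linearNr; ring. Qed.

Lemma dot_le_norm x y : dot x y <= `|x| * `|y|.
Proof.
have [->|x0] := eqVneq x 0; first by rewrite linear0l normr0 mul0r.
have [->|y0] := eqVneq y 0; first by rewrite linear0r normr0 mulr0.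
have xy0 : 0 < 2 * (`|x| * `|y|) by rewrite !mulr_gt0// normr_gt0.
rewrite -subr_ge0 -(pmulr_rge0 _ xy0).
suff <- : `| (`|y| *: x - `|x| *: y) | ^+ 2 =
    2 * (`|x| * `|y|) * (`|x| * `|y| - dot x y) by exact: sqr_ge0.
by rewrite sqr_normB dotZl dotZr /= !normrZ !normr_id; ring.
Qed.

Lemma dot_young (c : R) x y : 0 < c ->
  2 * dot x y <= c * `|x| ^+ 2 + c^-1 * `|y| ^+ 2.
Proof.
move=> c0; have := dot_le_norm x y.
have : 0 <= c^-1 * (c * `|x| - `|y|) ^+ 2.
  by rewrite mulr_ge0 ?sqr_ge0// invr_ge0 ltW.
have -> : c^-1 * (c * `|x| - `|y|) ^+ 2 =
    c * `|x| ^+ 2 + c^-1 * `|y| ^+ 2 - 2 * (`|x| * `|y|).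
  by field; rewrite gt_eqF.
lra.
Qed.

Lemma sqr_normD_le x y : `|x + y| ^+ 2 <= 2 * `|x| ^+ 2 + 2 * `|y| ^+ 2.
Proof.
by have := dot_young x y (@ltr01 R); rewrite sqr_normD invr1 !mul1r; lra.
Qed.

Lemma sqr_increment x y :
  2 * dot (x - y) x = `|x| ^+ 2 - `|y| ^+ 2 + `|x - y| ^+ 2.
Proof.
by rewrite sqr_normB dotBl /= dot_norm (dotC y x); ring.
Qed.

(* The weights 2 and 1/2 in Young's inequality for the mixed term cancel the
   contribution s |v|^2 of the difference operator exactly. *)
Lemma bdf2_test_increment (B : H -> H) (k s beta : R) (b a v v' x x' : H) :
  0 < k -> 0 <= s -> 0 < beta ->
  b = (1 + s) *: v - s *: v' + a ->
  dot a (k *: v) = dot (B x) (B x - B x') ->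
  `|B x| ^+ 2 + 2 * (1 - beta) * (k * `|v| ^+ 2) <=
    `|B x'| ^+ 2 + k * s / 2 * `|v'| ^+ 2 + k / (2 * beta) * `|b| ^+ 2.
Proof.
move=> k0 s0 beta0 bE aE.
have := sqr_ge0 (`|B x - B x'|); have := sqr_increment (B x) (B x').
rewrite dotC -aE dotZr /=.
have : 2 * dot b v <= (2 * beta)^-1 * `|b| ^+ 2 + 2 * beta * `|v| ^+ 2.
  have := dot_young b v (_ : 0 < (2 * beta)^-1); rewrite invrK; apply.
  by rewrite invr_gt0 mulr_gt0.
have : 2 * dot v' v <= 2^-1 * `|v'| ^+ 2 + 2 * `|v| ^+ 2.
  by have := dot_young v' v (_ : 0 < 2^-1); rewrite invrK; apply; rewrite invr_gt0.
rewrite bE dotDl dotBl !dotZl /= -bE dot_norm.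
move=> /(ler_wpM2l (mulr_ge0 (ltW k0) s0)) young1 /(ler_wpM2l (ltW k0)) young2.
rewrite (mulrC k (_^-1))//.
lra.
Qed.

Lemma bdf2_test_value (B : H -> H) (k s q g tau : R) (phi d a x x' x'' : H) :
  0 < k -> 0 < tau -> 0 <= q <= 1 + s ->
  k *: (phi + d) = (1 + s) *: (x - x') - q *: (x' - x'') + k *: a ->
  dot a x = `|B x| ^+ 2 -> `|phi| <= g * `|B x| ->
  (1 + s) * (`|x| ^+ 2 - `|x'| ^+ 2) + k * `|B x| ^+ 2 <=
    q * (`|x'| ^+ 2 - `|x''| ^+ 2)
    + k * (g ^+ 2 + tau) * `|x| ^+ 2 + k * (tau^-1 * `|d| ^+ 2)
    + 2 * q * `|x' - x''| ^+ 2.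
Proof.
move=> k0 tau0 /andP[q0 qs] eqn aE phi_le.
have dx := dot_young d x (_ : 0 < tau^-1); rewrite invrK invr_gt0 in dx.
have {}dx := dx tau0.
have phix : 2 * dot phi x <= `|B x| ^+ 2 + g ^+ 2 * `|x| ^+ 2.
  have := dot_le_norm phi x; have := ler_wpM2r (normr_ge0 x) phi_le.
  have := sqr_ge0 (`|B x| - g * `|x|).
  by rewrite sqrrB exprMn; lra.
have inc : dot (x - x') x = (`|x| ^+ 2 - `|x'| ^+ 2 + `|x - x'| ^+ 2) / 2.
  by have := sqr_increment x x'; lra.
have inc' : dot (x' - x'') x' =
    (`|x'| ^+ 2 - `|x''| ^+ 2 + `|x' - x''| ^+ 2) / 2.
  by have := sqr_increment x' x''; lra.
have cross := dot_young (x' - x'') (x - x') (@ltr01 R).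
rewrite invr1 !mul1r in cross.
have split : dot (x' - x'') x = dot (x' - x'') x' + dot (x' - x'') (x - x').
  by rewrite -dotDr addrCA subrr addr0.
have /(congr1 (dot^~ x)) := eqn.
rewrite dotDl dotBl /= !dotZl /= dotDl /= aE split inc inc' => main.
have young : k * (2 * (dot phi x + dot d x)) <=
    k * (`|B x| ^+ 2 + (g ^+ 2 + tau) * `|x| ^+ 2 + tau^-1 * `|d| ^+ 2).
  by rewrite ler_wpM2l ?(ltW k0)//; lra.
have := ler_wpM2l q0 cross.
have : 0 <= (1 + s - q) * `|x - x'| ^+ 2 by rewrite mulr_ge0 ?sqr_ge0// subr_ge0.
by move: young main; lra.
Qed.

End InnerProduct.

Ltac index_hyp P :=
  lazymatch P with
  | nat => idtac
  | @eq nat _ _ => idtac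
  | is_true (leq _ _) => idtac
  | is_true (andb (leq _ _) (leq _ _)) => idtac
  | is_true (negb _) => idtac
  end.

Ltac nat_lia :=
  repeat match goal with H : ?P |- _ => tryif index_hyp P then fail else clear H end;
  lia.

Lemma bigmax_sqr_le (R : realType) (F : nat -> R) (M : R) n : 0 <= M ->
  (forall j, (2 <= j <= n)%N -> 0 <= F j /\ F j ^+ 2 <= M) ->
  (\big[Num.max/0]_(2 <= j < n.+1) F j) ^+ 2 <= M.
Proof.
move=> M0 FM; rewrite -[leRHS]sqr_sqrtr// lerXn2r ?nnegrE ?sqrtr_ge0//.
  exact: bigmax_ge_id.
rewrite big_seq; apply: bigmax_le; first exact: sqrtr_ge0.
move=> j; rewrite mem_index_iota => jn; have [F0 Fj] := FM j jn.
by rewrite -(ger0_norm F0) -sqrtr_sqr ler_wsqrtr.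
Qed.

Section StepSizes.
Variables (R : realType) (T : R) (N : nat) (t : nat -> R).
Hypothesis part : partition_of t T N.
Local Notation k := (kstep t).
Local Notation r := (rstep t).
Local Notation s := (sstep t).

Lemma kstep_gt0 j : (1 <= j <= N)%N -> 0 < k j.
Proof.
case: part => _ _ inc; case: j => [//|j] jN.
by rewrite /kstep subr_gt0; apply: inc; nat_lia.
Qed.

Lemma rstep_gt0 j : (2 <= j <= N)%N -> 0 < r j.
Proof. by move=> jN; rewrite divr_gt0// kstep_gt0; nat_lia. Qed.

Lemma kstep_rstep j : (2 <= j <= N)%N -> k j = r j * k j.-1.
Proof.
by move=> jN; rewrite /rstep divfK// gt_eqF// kstep_gt0; nat_lia.
Qed.

Lemma sstep_itv j : (2 <= j <= N)%N -> 0 <= s j <= 1.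
Proof.
move=> /rstep_gt0 r0; rewrite /sstep divr_ge0 ?addr_ge0 ?(ltW r0)//=.
by rewrite ler_pdivrMr; lra.
Qed.

Lemma partition_mono i j : (i <= j <= N)%N -> t i <= t j.
Proof.
elim: j => [|j IH] ijN; first by rewrite (_ : i = 0%N)//; nat_lia.
have [->//|ij] := eqVneq i j.+1.
apply: (le_trans (IH ltac:(nat_lia))).
by case: part => _ _ inc; apply/ltW/inc; nat_lia.
Qed.

Lemma partition_Jint j : (1 <= j <= N)%N -> Jint T (t j).
Proof.
case: (part) => t0 tN inc jN; rewrite /Jint /=; apply/andP; split.
  have := partition_mono (_ : (1 <= j <= N)%N); have := inc 0%N.
  by rewrite t0 => /(_ ltac:(nat_lia)) lt /(_ jN); apply: lt_le_trans.
by rewrite -tN; apply: partition_mono; nat_lia.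
Qed.

Lemma sum_kstep_le n : (1 <= n <= N)%N -> \sum_(2 <= j < n.+1) k j <= t n.
Proof.
move=> nN; rewrite big_add1 /= (_ : \sum_(_ <= _ < _) _ = t n - t 1%N).
  have /= := partition_Jint (_ : (1 <= 1 <= N)%N); rewrite /Jint /=.
  by move=> /(_ ltac:(nat_lia)) /andP[]; lra.
by rewrite telescope_sumr//; nat_lia.
Qed.

Lemma kmax_ge0 n : 0 <= kmax t n.
Proof. exact: bigmax_ge_id. Qed.

Lemma kstep_le_kmax n j : (2 <= j <= n)%N -> k j <= kmax t n.
Proof. by move=> jn; apply: le_bigmax_seq => //; rewrite mem_index_iota; nat_lia. Qed.

Lemma rstep_le_rmax n j : (2 <= j <= n)%N -> r j <= rmax t n.
Proof. by move=> jn; apply: le_bigmax_seq => //; rewrite mem_index_iota; nat_lia. Qed.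

Lemma kmax_le_seq n : (n <= N)%N -> kmax t n <= kmax t N.
Proof.
move=> nN; rewrite /kmax big_seq; apply: bigmax_le (kmax_ge0 _) _ => j.
by rewrite mem_index_iota => jn; apply: kstep_le_kmax; nat_lia.
Qed.

Lemma kmax_le_time n : (1 <= n <= N)%N -> kmax t n <= t n.
Proof.
move=> nN; have /andP[tn _] := partition_Jint nN.
rewrite /kmax big_seq; apply: bigmax_le (ltW tn) _ => j.
rewrite mem_index_iota /kstep => jn.
have := partition_mono (_ : j <= n <= N)%N.
have /andP[] : Jint T (t j.-1) by apply: partition_Jint; nat_lia.
by move=> + _ /(_ ltac:(nat_lia)); lra.
Qed.

Lemma kstep_sstep_le (K c : R) j : rmax t N <= K ->
  K ^+ 2 <= c * (1 + K) -> (2 <= j <= N)%N -> k j * s j <= c * k j.-1.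
Proof.
move=> rK Kc jN; rewrite (kstep_rstep jN) mulrAC.
apply: ler_wpM2r; first by apply/ltW/kstep_gt0; nat_lia.
have r0 := rstep_gt0 jN; have rjK := le_trans (rstep_le_rmax jN) rK.
rewrite /sstep; move: (r j) r0 rjK => x x0 xK.
have K1 : 0 < 1 + K by lra.
rewrite mulrA ler_pdivrMr; last by lra.
rewrite -(ler_pM2r K1).
have : 0 <= (K - x) * (x + K + x * K).
  by apply: mulr_ge0; [lra | rewrite !addr_ge0 ?mulr_ge0//; lra].
have x1 : 0 <= 1 + x by lra.
by have := ler_wpM2r x1 Kc; lra.
Qed.

Lemma bdf2_ratio_le (K : R) j : rmax t N <= K -> (2 <= j <= N)%N ->
  r j * s j <= K ^+ 2 / (1 + 2 * K) * (1 + s j).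
Proof.
move=> rK jN.
have r0 := rstep_gt0 jN; have rjK := le_trans (rstep_le_rmax jN) rK.
rewrite /sstep; move: (r j) r0 rjK => x x0 xK.
have -> : 1 + x / (1 + x) = (1 + 2 * x) / (1 + x) by field; lra.
rewrite !mulrA ler_pM2r ?invr_gt0; last by lra.
rewrite mulrAC ler_pdivlMr; last by lra.
have : 0 <= (K - x) * (x + K + 2 * x * K).
  by apply: mulr_ge0; [lra | rewrite !addr_ge0 ?mulr_ge0//; lra].
lra.
Qed.

End StepSizes.

Section ErrorEquation.
Variables (R : realType) (H : completeNormedModType R) (dot : {dot H for idfun}).
Variables (A B : operator H) (T : R) (f : R -> H -> H) (gamma : R -> R).
Variables (u0 : H) (u : R -> H) (N : nat) (t : nat -> R) (U : nat -> H) (c4 : R).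
Hypotheses (dot_norm : hilbert_norm dot) (Asa : self_adjoint dot A)
  (AB : is_sqrt_operator dot A B) (rate : lipschitz_rate T gamma)
  (sol : parabolic_solution A T f u0 u) (lip : locally_lipschitz B T u gamma f)
  (part : partition_of t T N) (scheme : bdf2_solution t A N f u0 U)
  (UV : forall n, (2 <= n <= N)%N -> tube B (u (t n)) (U n))
  (cons : forall n, (2 <= n <= N)%N ->
     `|consistency_error t A f u n| <= c4 * kstep t n ^+ 2).

Local Notation k := (kstep t).
Local Notation s := (sstep t).
Local Notation r := (rstep t).
Local Notation g := (gamma_max T gamma).
Local Notation a := (4 + 2 * Num.sqrt 2 : R).

Definition scheme_error (j : nat) : H := u (t j) - U j.
Local Notation e := scheme_error.

Lemma scheme_error0 : e 0%N = 0.
Proof.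
rewrite /scheme_error; case: part => -> _ _.
by rewrite (sol_init sol) (bdf2_init scheme) subrr.
Qed.

Lemma op_dom_error j : (1 <= j <= N)%N -> op_dom A (e j).
Proof.
move=> jN; case: Asa => -[_ lin _] _ _.
rewrite /scheme_error addrC -scaleN1r; apply: lin; first by apply: (bdf2_dom scheme); nat_lia.
exact: (sol_dom sol (partition_Jint part jN)).
Qed.

Lemma op_error j : (1 <= j <= N)%N -> A (e j) = A (u (t j)) - A (U j).
Proof.
move=> jN; case: Asa => -[_ _ lin] _ _.
rewrite /scheme_error addrC -scaleN1r lin; first by rewrite scaleN1r addrC.
  by apply: (bdf2_dom scheme); nat_lia.
exact: (sol_dom sol (partition_Jint part jN)).
Qed.

Lemma sqrt_dom_error j : (1 <= j <= N)%N -> op_dom B (e j).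
Proof. by case: AB => _ _ dom _ /op_dom_error /dom[]. Qed.

Lemma sqrt_op_dot x y : op_dom A x -> op_dom B y -> dot (A x) y = dot (B x) (B y).
Proof.
case: AB => -[_ _ adj] _ dom eqA Ax By.
have [Bx BBx] := (dom x).1 Ax.
by rewrite (eqA _ Ax); have [_] := adj y (B y); apply.
Qed.

Lemma error_equation j : (2 <= j <= N)%N ->
  dbarB2 t e j + A (e j) =
  (f (t j) (u (t j)) - f (t j) (U j)) + consistency_error t A f u j.
Proof.
move=> jN; rewrite /consistency_error -(bdf2_eq scheme jN) op_error; last by nat_lia.
have -> : dbarB2 t e j = dbarB2 t (fun i => u (t i)) j - dbarB2 t U j.
  have dbarB i : dbar t e i = dbar t (fun i => u (t i)) i - dbar t U i.
    rewrite /dbar -scalerBr /scheme_error; congr (_ *: _).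
    by rewrite !opprD !opprK addrACA.
  by rewrite /dbarB2 !dbarB !scalerBr !opprD !opprK addrACA.
move: (dbarB2 _ _ _) (dbarB2 _ _ _) (A _) (A _) (f _ _) => x y z w v.
by rewrite [RHS]addrC [RHS]subrKA opprD addrACA.
Qed.

Lemma sqrt_op_lin x y : op_dom B x -> op_dom B y ->
  op_dom B (x - y) /\ B (x - y) = B x - B y.
Proof.
case: AB => -[[_ dom lin] _ _] _ _ _ Bx By.
rewrite addrC -scaleN1r; split; first exact: dom.
by rewrite lin// scaleN1r addrC.
Qed.

Lemma rate_itv j : (1 <= j <= N)%N -> 0 <= gamma (t j) <= g.
Proof.
move=> /(partition_Jint part) tj; rewrite (rate_ge0 rate tj) /=.
by apply: ub_le_sup; [exact: rate_bounded rate | exists (t j)].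
Qed.

Lemma nonlinearity_error_le j : (2 <= j <= N)%N ->
  `|f (t j) (u (t j)) - f (t j) (U j)| <= gamma (t j) * `|B (e j)|.
Proof.
move=> jN; have tj := partition_Jint part (_ : (1 <= j <= N)%N).
apply: lip (tj ltac:(nat_lia)) _ _ _ (UV jN).
have Bu : op_dom B (u (t j)).
  by case: AB => _ _ /(_ (u (t j)))[+ _] _ => /(_ (sol_dom sol (tj ltac:(nat_lia))))[].
by split=> //; rewrite /normV (sqrt_op_lin Bu Bu).2 subrr normr0.
Qed.

Local Notation V j := (`|B (e j)| ^+ 2).
Local Notation W j := (`|dbar t e j| ^+ 2).

Lemma increment_estimate (beta : R) j : 0 < beta -> (2 <= j <= N)%N ->
  V j + 2 * (1 - beta) * (k j * W j) <=
    V j.-1 + k j * s j / 2 * W j.-1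
    + beta^-1 * (gamma (t j) ^+ 2 * k j * V j + c4 ^+ 2 * k j ^+ 5).
Proof.
move=> beta0 jN.
have k0 : 0 < k j by apply: (kstep_gt0 part); nat_lia.
have /andP[s0 _] := sstep_itv part jN.
have eqn := esym (error_equation jN).
have Be := sqrt_dom_error (_ : (1 <= j <= N)%N).
have Be' := sqrt_dom_error (_ : (1 <= j.-1 <= N)%N).
have [Bd Bdiff] := sqrt_op_lin (Be ltac:(nat_lia)) (Be' ltac:(nat_lia)).
have := bdf2_test_increment dot_norm k0 s0 beta0 eqn
  (_ : _ = dot (B (e j)) (B (e j) - B (e j.-1))).
rewrite /dbar !scalerA mulfV ?gt_eqF// scale1r -/(dbar t e j.-1) -/(dbar t e j).
rewrite -Bdiff -sqrt_op_dot//; last by apply: op_dom_error; nat_lia.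
move=> /(_ erefl) le1; apply: (le_trans le1); rewrite lerD2l.
have phi_le := nonlinearity_error_le jN; have d_le := cons jN.
have := sqr_normD_le dot_norm (f (t j) (u (t j)) - f (t j) (U j))
  (consistency_error t A f u j).
set b2 := `|_ + _| ^+ 2 => b2_le.
have phi2 : `|f (t j) (u (t j)) - f (t j) (U j)| ^+ 2 <= gamma (t j) ^+ 2 * V j.
  by rewrite -exprMn lerXn2r ?nnegrE// (le_trans _ phi_le).
have d2 : `|consistency_error t A f u j| ^+ 2 <= c4 ^+ 2 * k j ^+ 4.
  have -> : c4 ^+ 2 * k j ^+ 4 = (c4 * k j ^+ 2) ^+ 2 by ring.
  by rewrite lerXn2r ?nnegrE// (le_trans _ d_le).
rewrite (_ : k j / _ = beta^-1 * (k j / 2)); last by field; rewrite gt_eqF.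
rewrite -[leLHS]mulrA; apply: ler_wpM2l; first by rewrite invr_ge0 ltW.
apply: (@le_trans _ _ (k j * (gamma (t j) ^+ 2 * V j + c4 ^+ 2 * k j ^+ 4))).
  by rewrite -[leLHS]mulrA; apply: ler_wpM2l; [exact: ltW | lra].
by rewrite le_eqVlt; apply/orP; left; apply/eqP; ring.
Qed.

Lemma rate_step_itv j : (2 <= j <= N)%N ->
  0 <= gamma (t j) ^+ 2 * k j <= g ^+ 2 * kmax t N.
Proof.
move=> jN; have jN' : (1 <= j <= N)%N by nat_lia.
have /andP[g0 gg] := rate_itv jN'; have k0 := ltW (kstep_gt0 part jN').
rewrite mulr_ge0 ?sqr_ge0//= ler_pM ?sqr_ge0//; last exact: kstep_le_kmax.
by rewrite lerXn2r// nnegrE (le_trans g0).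
Qed.

Lemma energy_estimate (beta theta lam c : R) n : (2 <= n <= N)%N ->
  0 < beta -> beta^-1 <= lam -> 0 <= theta <= 1 - beta ->
  (forall j, (3 <= j <= n)%N -> k j * s j <= 4 * theta * k j.-1) ->
  lam * g ^+ 2 * kmax t N <= c -> c < 1 ->
  forall m, (2 <= m <= n)%N ->
  V m + 2 * (1 - beta - theta) * \sum_(2 <= j < m.+1) k j * W j <=
    expR (lam / (1 - c) * \sum_(2 <= j < n.+1) gamma (t j) ^+ 2 * k j) *
    (V 1%N + k 2%N * s 2%N / 2 * W 1%N + lam * c4 ^+ 2 * kmax t n ^+ 4 * t n).
Proof.
move=> nN beta0 blam /andP[th0 th1] step lamc c1 m mn.
have lam0 : 0 <= lam by apply: le_trans blam; rewrite invr_ge0 ltW.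
pose S m := \sum_(2 <= j < m.+1) k j * W j.
pose F m := if (m <= 1)%N then V 1%N + k 2%N * s 2%N / 2 * W 1%N
  else V m + 2 * theta * (k m * W m) + 2 * (1 - beta - theta) * S m.
pose x j := lam * (gamma (t j) ^+ 2 * k j).
pose G j := lam * (c4 ^+ 2 * k j ^+ 5).
have kW0 j : (1 <= j <= N)%N -> 0 <= k j * W j.
  by move=> jN; rewrite mulr_ge0 ?exprn_ge0// ltW// (kstep_gt0 part).
have S0 i : (i <= n)%N -> 0 <= S i.
  move=> iN; rewrite /S big_nat; apply: sumr_ge0 => j ji; apply: kW0; nat_lia.
have x0 j : (2 <= j <= n)%N -> 0 <= x j <= c.
  move=> jn; have jN : (2 <= j <= N)%N by nat_lia.
  have /andP[gk0 gkc] := rate_step_itv jN.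
  by rewrite mulr_ge0//= (le_trans _ lamc)// -mulrA ler_wpM2l.
have G0 j : (2 <= j <= n)%N -> 0 <= G j.
  move=> jn; have kj : 0 < k j by apply: (kstep_gt0 part); nat_lia.
  apply: mulr_ge0 => //; apply: mulr_ge0; first exact: sqr_ge0.
  by apply/exprn_ge0/ltW.
have stepF j : (2 <= j <= n)%N -> F j <= F j.-1 + x j * F j + G j.
  move=> jn; have jN : (2 <= j <= N)%N by nat_lia.
  have one := increment_estimate beta0 jN.
  have src : beta^-1 * (gamma (t j) ^+ 2 * k j * V j + c4 ^+ 2 * k j ^+ 5) <=
      x j * F j + G j.
    have kj : 0 < k j by apply: (kstep_gt0 part); nat_lia.
    apply: (@le_trans _ _
        (lam * (gamma (t j) ^+ 2 * k j * V j + c4 ^+ 2 * k j ^+ 5))).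
      rewrite ler_wpM2r// addr_ge0// mulr_ge0 ?sqr_ge0 ?exprn_ge0 ?(ltW kj)//.
      by rewrite mulr_ge0 ?sqr_ge0 ?(ltW kj).
    rewrite mulrDr lerD2r /x -[leRHS]mulrA.
    apply: ler_wpM2l => //; apply: ler_wpM2l.
      by rewrite mulr_ge0 ?sqr_ge0 ?(ltW kj).
    have -> : F j = V j + 2 * theta * (k j * W j) + 2 * (1 - beta - theta) * S j.
      by rewrite /F leqNgt; case/andP: jn => ->.
    rewrite -addrA lerDl; apply: addr_ge0; apply: mulr_ge0.
    - by rewrite mulr_ge0.
    - by apply: kW0; nat_lia.
    - by rewrite mulr_ge0//; lra.
    - by apply: S0; nat_lia.
  rewrite -addrA.
  have [j2|j2] := eqVneq j 2%N.
    rewrite j2 /= in one src *; rewrite {1 2}/F /= /S big_nat1; lra.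
  have [i ji] : exists i, j = i.+3 by exists (j - 3)%N; nat_lia.
  rewrite ji /= in jn jN one src *.
  have := step i.+3 jn => /= kk.
  have Wi : 0 <= W i.+2 by exact: sqr_ge0.
  have := ler_wpM2r Wi kk.
  rewrite {1 2}/F /= /S (@big_nat_recr _ _ _ i.+3)//=.
  by rewrite -/(S i.+2); lra.
have F1 : 0 <= F 1%N.
  have /andP[s0 _] : 0 <= s 2%N <= 1 by apply: (sstep_itv part); nat_lia.
  have k0 : 0 <= k 2%N by apply/ltW/(kstep_gt0 part); nat_lia.
  by rewrite /F /= addr_ge0 ?sqr_ge0// mulr_ge0 ?sqr_ge0// divr_ge0// mulr_ge0.
have := discrete_gronwall c1 F1 x0 G0 stepF (_ : 1 <= m <= n)%N.
move=> /(_ ltac:(nat_lia)) Fm.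
have {}Fm : V m + 2 * (1 - beta - theta) * S m <=
    expR ((1 - c)^-1 * \sum_(2 <= j < m.+1) x j) *
    (F 1%N + \sum_(2 <= j < m.+1) G j).
  apply: le_trans Fm.
  rewrite [F m]/F leqNgt; have /andP[-> _] /= := mn.
  rewrite lerD2r lerDl; apply: mulr_ge0; first by rewrite mulr_ge0.
  by apply: kW0; nat_lia.
apply: (le_trans Fm); apply: ler_pM; rewrite ?expR_ge0//.
- rewrite addr_ge0// big_nat; apply: sumr_ge0 => j jm; apply: G0; nat_lia.
- rewrite ler_expR -mulr_sumr [lam / _]mulrC -[leRHS]mulrA.
  apply: ler_wpM2l; first by rewrite invr_ge0 subr_ge0 ltW.
  apply: ler_wpM2l => //.
  rewrite [leRHS](@big_cat_nat _ _ _ m.+1)//=; try nat_lia.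
  rewrite lerDl big_nat; apply: sumr_ge0 => j jm.
  have jN : (2 <= j <= N)%N by nat_lia.
  by have /andP[] := rate_step_itv jN.
rewrite /F /= lerD2l.
apply: (@le_trans _ _ (lam * c4 ^+ 2 * kmax t n ^+ 4 *
                       \sum_(2 <= j < m.+1) k j)).
  rewrite mulr_sumr big_nat [leRHS]big_nat; apply: ler_sum => j jm.
  have kj : 0 < k j by apply: (kstep_gt0 part); nat_lia.
  have -> : G j = lam * c4 ^+ 2 * k j ^+ 4 * k j by rewrite /G; ring.
  apply: ler_wpM2r; first exact: ltW.
  apply: ler_wpM2l; first by rewrite mulr_ge0 ?sqr_ge0.
  by rewrite lerXn2r ?nnegrE ?(ltW kj) ?kmax_ge0// kstep_le_kmax//; nat_lia.
apply: ler_wpM2l.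
  apply: mulr_ge0; first by rewrite mulr_ge0 ?sqr_ge0.
  by rewrite exprn_ge0// kmax_ge0.
apply: (le_trans (sum_kstep_le part _)); first by nat_lia.
by apply: (partition_mono part); nat_lia.
Qed.

Local Notation y j := (`|e j| ^+ 2).
Local Notation z j := (`|e j - e j.-1| ^+ 2).

Lemma value_estimate_step (K tau : R) j : 0 < tau -> 1 < K ->
  K ^+ 2 <= 1 + 2 * K -> rmax t N <= K -> (2 <= j <= N)%N ->
  y j - y j.-1 + k j * V j / 2 <=
    r j * s j / (1 + s j) * (y j.-1 - y j.-2)
    + (k j * (gamma (t j) ^+ 2 + tau) * y j
       + (tau^-1 * c4 ^+ 2 * k j ^+ 5 + 2 * z j.-1)).
Proof.
move=> tau0 K1 K2 rK jN.
have kj : 0 < k j by apply: (kstep_gt0 part); nat_lia.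
have kj' : 0 < k j.-1 by apply: (kstep_gt0 part); nat_lia.
have /andP[s0 s1] := sstep_itv part jN.
have q0 : 0 <= r j * s j by rewrite mulr_ge0 ?(ltW (rstep_gt0 part jN)).
have qs : r j * s j <= 1 + s j.
  apply: (le_trans (bdf2_ratio_le part rK jN)).
  rewrite ger_pMl; last by lra.
  by rewrite ler_pdivrMr; lra.
have eqn : k j *: (f (t j) (u (t j)) - f (t j) (U j)
    + consistency_error t A f u j) =
    (1 + s j) *: (e j - e j.-1) - (r j * s j) *: (e j.-1 - e j.-2)
    + k j *: A (e j).
  rewrite -(error_equation jN) scalerDr; congr (_ + _).
  rewrite /dbarB2 /dbar scalerBr !scalerA; congr (_ *: _ - _ *: _).
    by field; rewrite gt_eqF.
  by rewrite /rstep; field; rewrite gt_eqF.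
have Ax : dot (A (e j)) (e j) = V j.
  by rewrite sqrt_op_dot ?dot_norm//; [apply: op_dom_error|apply: sqrt_dom_error]; nat_lia.
have main := bdf2_test_value dot_norm kj tau0 (_ : 0 <= _ <= _) eqn Ax
  (nonlinearity_error_le jN).
rewrite q0 qs in main; have {}main := main isT.
have d2 : `|consistency_error t A f u j| ^+ 2 <= c4 ^+ 2 * k j ^+ 4.
  have -> : c4 ^+ 2 * k j ^+ 4 = (c4 * k j ^+ 2) ^+ 2 by ring.
  by rewrite lerXn2r ?nnegrE// (le_trans _ (cons jN)).
have src : k j * (tau^-1 * `|consistency_error t A f u j| ^+ 2) <=
    tau^-1 * c4 ^+ 2 * k j ^+ 5.
  rewrite (_ : tau^-1 * _ * _ = k j * (tau^-1 * (c4 ^+ 2 * k j ^+ 4))); last by ring.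
  by rewrite ler_pM2l// ler_pM2l// invr_gt0.
have p0 : 0 < 1 + s j by lra.
rewrite -(ler_pM2r p0) [leRHS]mulrDl [_ / _ * _ * _]mulrAC divfK ?gt_eqF//.
set h := k j * (_ + tau) * y j.
have h0 : 0 <= h.
  by rewrite mulr_ge0 ?sqr_ge0// mulr_ge0 ?(ltW kj)// addr_ge0 ?sqr_ge0// ltW.
set d := tau^-1 * _ * _ in src *.
have d0 : 0 <= d.
  apply: le_trans src; apply: mulr_ge0; first exact: ltW.
  by rewrite mulr_ge0 ?sqr_ge0// invr_ge0 ltW.
have kV : 0 <= k j * V j by rewrite mulr_ge0 ?sqr_ge0 ?(ltW kj).
have z0 : 0 <= z j.-1 by exact: sqr_ge0.
rewrite -/h in main.
have := mulr_ge0 s0 h0; have := mulr_ge0 s0 d0.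
have : 0 <= (1 - s j) * (k j * V j) by rewrite mulr_ge0//; lra.
have : 0 <= (1 + s j - r j * s j) * z j.-1 by rewrite mulr_ge0//; lra.
move: (r j * s j) main => q; lra.
Qed.

Lemma value_estimate (K c2 : R) n : let c3 := (1 + K) ^+ 2 / (1 + 2 * K - K ^+ 2) in
  (2 <= n <= N)%N -> 1 < K -> K ^+ 2 < 1 + 2 * K -> rmax t N <= K ->
  2 * c3 * g ^+ 2 * kmax t N <= c2 -> c2 < 1 ->
  forall m, (2 <= m <= n)%N ->
  y m + (\sum_(2 <= j < m.+1) k j * V j) / 2 <=
    expR (4 * c3 * g ^+ 2 * t n + 1) *
    (y 1%N + c3 * (3 * y 1%N + 4 * c3 * c4 ^+ 2 * t n ^+ 2 * kmax t n ^+ 4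
       + 2 * kmax t n * \sum_(2 <= j < n.+1) k j * W j)).
Proof.
move=> c3 nN K1 K2 rK c2g c21 m mn.
have tn : 0 < t n by have /andP[] : Jint T (t n) by apply: (partition_Jint part); nat_lia.
have Kp : 0 < 1 + 2 * K - K ^+ 2 by lra.
have c30 : 0 < c3 by rewrite divr_gt0// exprn_gt0//; lra.
pose q := K ^+ 2 / (1 + 2 * K).
have q1 : q < 1 by rewrite ltr_pdivrMr; lra.
have qc3 : (1 - q)^-1 <= c3.
  have -> : (1 - q)^-1 = (1 + 2 * K) / (1 + 2 * K - K ^+ 2).
    by rewrite /q; field; rewrite !gt_eqF//=; lra.
  by rewrite ler_pM2r ?invr_gt0//; have := sqr_ge0 K; lra.
clearbody c3.
have kp j : (1 <= j <= N)%N -> 0 < k j by exact: (kstep_gt0 part).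
pose tau := (4 * c3 * t n)^-1.
have tau0 : 0 < tau by rewrite invr_gt0 mulr_gt0// mulr_gt0.
pose x j := c3 * (k j * (gamma (t j) ^+ 2 + tau)).
pose d j := tau^-1 * c4 ^+ 2 * k j ^+ 5 + 2 * z j.-1.
pose M := y 1%N + c3 * (y 1%N + \sum_(2 <= j < n.+1) d j).
pose S m := M + \sum_(2 <= j < m.+1) x j * y j.
have d0 j : (2 <= j <= n)%N -> 0 <= d j.
  move=> jn; have kj : 0 < k j by apply: kp; nat_lia.
  apply: addr_ge0; last by rewrite mulr_ge0 ?sqr_ge0.
  apply: mulr_ge0; last by apply/exprn_ge0/ltW.
  by rewrite mulr_ge0 ?sqr_ge0// invr_ge0 ltW.
have kt0 j : (2 <= j <= n)%N -> 0 <= k j * (gamma (t j) ^+ 2 + tau).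
  move=> jn; have kj : 0 < k j by apply: kp; nat_lia.
  by rewrite mulr_ge0 ?(ltW kj)// addr_ge0 ?sqr_ge0 ?(ltW tau0).
have xE j : x j = c3 * (gamma (t j) ^+ 2 * k j) + k j / (4 * t n).
  by rewrite /x /tau; field; rewrite !gt_eqF.
have x0 j : (2 <= j <= n)%N -> 0 <= x j <= 3 / 4.
  move=> jn; have jN : (2 <= j <= N)%N by nat_lia.
  rewrite mulr_ge0 ?kt0 ?(ltW c30)//= xE.
  have /andP[_ gk] := rate_step_itv jN.
  have := ler_wpM2l (ltW c30) gk.
  have : k j / (4 * t n) <= 1 / 4.
    rewrite ler_pdivrMr ?mulr_gt0//.
    have := kstep_le_kmax t (_ : (2 <= j <= n)%N); move=> /(_ jn).
    have := kmax_le_time part (_ : (1 <= n <= N)%N); move=> /(_ ltac:(nat_lia)); lra.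
  lra.
have M0 : 0 <= M.
  rewrite addr_ge0 ?sqr_ge0// mulr_ge0 ?(ltW c30)// addr_ge0 ?sqr_ge0//.
  by rewrite big_nat; apply: sumr_ge0 => j jn; apply: d0; nat_lia.
have yS i : (1 <= i <= n)%N -> y i + (\sum_(2 <= j < i.+1) k j * V j) / 2 <= S i.
  move=> iN.
  pose Y j := y j - y j.-1.
  pose h j := k j * (gamma (t j) ^+ 2 + tau) * y j + d j.
  have h0 j : (2 <= j <= n)%N -> 0 <= h j.
    by move=> jn; rewrite addr_ge0 ?d0// mulr_ge0 ?kt0 ?sqr_ge0.
  have Y1 : Y 1%N = y 1%N by rewrite /Y /= scheme_error0 normr0 expr0n subr0.
  have Y0 : 0 <= Y 1%N by rewrite Y1 sqr_ge0.
  have D0 j : (2 <= j <= n)%N -> 0 <= k j * V j / 2.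
    move=> jn; have kj : 0 < k j by apply: kp; nat_lia.
    by rewrite divr_ge0// mulr_ge0 ?sqr_ge0 ?(ltW kj).
  have rho0 j : (2 <= j <= n)%N -> 0 <= r j * s j / (1 + s j) <= q.
    move=> jn; have jN : (2 <= j <= N)%N by nat_lia.
    have /andP[s0 s1] := sstep_itv part jN.
    have p0 : 0 < 1 + s j by lra.
    apply/andP; split; first by rewrite divr_ge0 ?(ltW p0)// mulr_ge0// ltW// (rstep_gt0 part).
    by rewrite ler_pdivrMr//; exact: (bdf2_ratio_le part rK jN).
  have stepY j : (2 <= j <= n)%N ->
      Y j + k j * V j / 2 <= r j * s j / (1 + s j) * Y j.-1 + h j.
    move=> jn; have jN : (2 <= j <= N)%N by nat_lia.
    exact: (value_estimate_step tau0 K1 (ltW K2) rK jN).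
  have := contraction_sum q1 Y0 rho0 h0 D0 stepY iN.
  have -> : \sum_(2 <= j < i.+1) Y j = y i - y 1%N.
    by rewrite big_add1 /= telescope_sumr//; nat_lia.
  rewrite -mulr_suml Y1.
  have hd : \sum_(2 <= j < i.+1) h j <=
      \sum_(2 <= j < i.+1) k j * (gamma (t j) ^+ 2 + tau) * y j +
      \sum_(2 <= j < n.+1) d j.
    rewrite big_split lerD2l [leRHS](@big_cat_nat _ _ _ i.+1)//=; try nat_lia.
    by rewrite lerDl big_nat; apply: sumr_ge0 => j ji; apply: d0; nat_lia.
  have h0' : 0 <= y 1%N + \sum_(2 <= j < i.+1) h j.
    by rewrite addr_ge0 ?sqr_ge0// big_nat; apply: sumr_ge0 => j ji; apply: h0; nat_lia.
  have le1 := ler_wpM2r h0' qc3.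
  have le2 := ler_wpM2l (ltW c30) hd.
  have -> : S i = M + c3 * \sum_(2 <= j < i.+1)
      k j * (gamma (t j) ^+ 2 + tau) * y j.
    by rewrite /S mulr_sumr; congr (_ + _); apply: eq_bigr => j _; rewrite mulrA.
  by rewrite /M; lra.
have c34 : 3 / 4 < 1 :> R by lra.
have S1 : S 1%N = M by rewrite /S big_geq ?addr0.
have S10 : 0 <= S 1%N by rewrite S1.
have stepS j : (2 <= j <= n)%N -> S j <= S j.-1 + x j * S j + 0.
  case: j => [//|j] jn; have /andP[xj _] := x0 _ jn.
  rewrite addr0 [S j.+1 in leLHS]/S big_nat_recr/=; last by nat_lia.
  rewrite addrA lerD2l; apply: ler_wpM2l => //.
  apply: (le_trans _ (yS j.+1 _)); last by nat_lia.
  rewrite lerDl divr_ge0// big_nat; apply: sumr_ge0 => i ij.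
  have ki : 0 < k i by apply: kp; nat_lia.
  by rewrite mulr_ge0 ?sqr_ge0 ?(ltW ki).
have m1 : (1 <= m <= n)%N by nat_lia.
have := discrete_gronwall c34 S10 x0 (fun _ _ => lexx 0) stepS m1.
rewrite S1 big1_eq addr0 => Sm.
apply: (le_trans (yS m m1)); apply: (le_trans Sm).
apply: ler_pM; rewrite ?expR_ge0//.
  rewrite ler_expR (_ : (1 - 3 / 4)^-1 = 4); last by field.
  have : \sum_(2 <= j < m.+1) x j <=
      (c3 * g ^+ 2 + (4 * t n)^-1) * \sum_(2 <= j < m.+1) k j.
    rewrite mulr_sumr big_nat [leRHS]big_nat; apply: ler_sum => j jm.
    have jN : (1 <= j <= N)%N by nat_lia.
    have kj := kp _ jN; have /andP[g0 gg] := rate_itv jN.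
    have g2 : gamma (t j) ^+ 2 <= g ^+ 2 by rewrite lerXn2r// nnegrE (le_trans g0).
    have := ler_wpM2l (ltW c30) (ler_wpM2r (ltW kj) g2).
    by rewrite xE; lra.
  have : 0 <= c3 * g ^+ 2 + (4 * t n)^-1.
    apply: addr_ge0; last by rewrite invr_ge0 mulr_ge0 ?(ltW tn).
    by apply: mulr_ge0; [exact: ltW|exact: sqr_ge0].
  have sumk : \sum_(2 <= j < m.+1) k j <= t n.
    apply: le_trans (partition_mono part (_ : (m <= n <= N)%N)); last by nat_lia.
    by apply: (sum_kstep_le part); nat_lia.
  move=> /ler_wpM2l /(_ _ _ sumk).
  have -> : (c3 * g ^+ 2 + (4 * t n)^-1) * t n = c3 * g ^+ 2 * t n + 1 / 4.
    by field; rewrite gt_eqF.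
  lra.
rewrite /M lerD2l ler_pM2l//.
have kn0 := kmax_ge0 t n.
have zE : \sum_(2 <= j < n.+1) z j.-1 = y 1%N + \sum_(2 <= j < n) z j.
  rewrite big_add1 /= big_ltn; last by nat_lia.
  by rewrite scheme_error0 subr0.
rewrite big_split /= -[X in _ + (_ + X)]mulr_sumr zE.
have src : \sum_(2 <= j < n.+1) tau^-1 * c4 ^+ 2 * k j ^+ 5 <=
    4 * c3 * c4 ^+ 2 * t n ^+ 2 * kmax t n ^+ 4.
  have -> : 4 * c3 * c4 ^+ 2 * t n ^+ 2 * kmax t n ^+ 4 =
      tau^-1 * c4 ^+ 2 * kmax t n ^+ 4 * t n by rewrite /tau invrK; ring.
  apply: (@le_trans _ _ (tau^-1 * c4 ^+ 2 * kmax t n ^+ 4 *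
                         \sum_(2 <= j < n.+1) k j)).
    rewrite mulr_sumr big_nat [leRHS]big_nat; apply: ler_sum => j jn.
    have kj : 0 < k j by apply: kp; nat_lia.
    have -> : tau^-1 * c4 ^+ 2 * k j ^+ 5 = tau^-1 * c4 ^+ 2 * k j ^+ 4 * k j by ring.
    apply: ler_wpM2r; first exact: ltW.
    apply: ler_wpM2l; first by rewrite mulr_ge0 ?sqr_ge0// invr_ge0 ltW.
    by rewrite lerXn2r ?nnegrE ?(ltW kj)// kstep_le_kmax//; nat_lia.
  apply: ler_wpM2l; last by apply: (sum_kstep_le part); nat_lia.
  apply: mulr_ge0; last exact: exprn_ge0.
  by rewrite mulr_ge0 ?sqr_ge0// invr_ge0 ltW.
have zW : \sum_(2 <= j < n) z j <= kmax t n * \sum_(2 <= j < n.+1) k j * W j.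
  apply: (@le_trans _ _ (\sum_(2 <= j < n) kmax t n * (k j * W j))).
    rewrite big_nat [leRHS]big_nat; apply: ler_sum => j jn.
    have kj : 0 < k j by apply: kp; nat_lia.
    have -> : z j = k j * (k j * W j).
      rewrite /dbar normrZ exprMn normfV (gtr0_norm kj).
      by field; rewrite gt_eqF.
    by rewrite ler_wpM2r ?mulr_ge0 ?sqr_ge0 ?(ltW kj)// kstep_le_kmax//; nat_lia.
  rewrite -mulr_sumr ler_wpM2l// big_nat_recr/=; last by nat_lia.
  have kj : 0 < k n by apply: kp; nat_lia.
  by rewrite lerDl mulr_ge0 ?sqr_ge0 ?(ltW kj).
move: zW src; lra.
Qed.

Lemma l2V_sqr n : (n <= N)%N ->
  l2V t B e 2 n ^+ 2 = \sum_(2 <= j < n.+1) k j * V j.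
Proof.
move=> nN; rewrite /l2V sqr_sqrtr// big_nat; apply: sumr_ge0 => j jn.
by rewrite mulr_ge0 ?sqr_ge0// ltW// (kstep_gt0 part)//; nat_lia.
Qed.

Lemma l2HH_sqr_le n : (2 <= n <= N)%N ->
  l2HH t e 2 n ^+ 2 <= \sum_(2 <= j < n.+1) k j * W j.
Proof.
move=> nN.
have kW j : (2 <= j <= N)%N -> 0 <= k j * s j * W j <= k j * W j.
  move=> jN; have /andP[s0 s1] := sstep_itv part jN.
  have kj : 0 < k j by apply: (kstep_gt0 part); nat_lia.
  have ks : 0 <= k j * s j by apply: mulr_ge0 => //; exact: ltW.
  rewrite mulr_ge0 ?sqr_ge0//=.
  by rewrite ler_wpM2r ?sqr_ge0// ler_piMr ?(ltW kj).
rewrite /l2HH sqr_sqrtr; last first.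
  rewrite big_nat; apply: sumr_ge0 => j jn.
  by have /andP[] : 0 <= k j * s j * W j <= k j * W j by apply: kW; nat_lia.
rewrite big_nat_recr/=; last by nat_lia.
apply: ler_wpDr.
  have /andP[k1] : 0 <= k n * s n * W n <= k n * W n by apply: kW; nat_lia.
  exact: le_trans.
rewrite big_nat [leRHS]big_nat; apply: ler_sum => j jn.
by have /andP[] : 0 <= k j * s j * W j <= k j * W j by apply: kW; nat_lia.
Qed.

Lemma dbar_error1 : W 1%N = (k 1%N)^-1 ^+ 2 * y 1%N.
Proof.
by rewrite /dbar /= scheme_error0 subr0 normrZ exprMn real_normK ?num_real.
Qed.

Lemma initial_energy_ge0 (lam : R) n : (2 <= n <= N)%N -> 0 <= lam ->
  0 <= V 1%N + k 2%N * s 2%N / 2 * W 1%N + lam * c4 ^+ 2 * kmax t n ^+ 4 * t n.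
Proof.
move=> nN lam0.
have tn : 0 < t n by have /andP[] : Jint T (t n) by apply: (partition_Jint part); nat_lia.
have /andP[s0 _] : 0 <= s 2%N <= 1 by apply: (sstep_itv part); nat_lia.
have k0 : 0 <= k 2%N by apply/ltW/(kstep_gt0 part); nat_lia.
have ks : 0 <= k 2%N * s 2%N by exact: mulr_ge0.
have k4 : 0 <= kmax t n ^+ 4 by rewrite exprn_ge0// kmax_ge0.
apply: addr_ge0.
  by rewrite addr_ge0 ?sqr_ge0// mulr_ge0 ?sqr_ge0// divr_ge0.
apply: mulr_ge0; last exact: ltW.
by apply: mulr_ge0 => //; rewrite mulr_ge0 ?sqr_ge0.
Qed.

Lemma kmax4_le n : (n <= N)%N -> kmax t n ^+ 4 <= kmax t N ^+ 4.
Proof. by move=> nN; rewrite lerXn2r ?nnegrE ?kmax_ge0// kmax_le_seq. Qed.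

Lemma error_V_below_R1 (K cR c1 : R) n : (2 <= n <= N)%N ->
  rmax t N <= K -> 1 < K -> K < (3 + Num.sqrt 17) / 2 ->
  Num.max ((2 + 2 * K) / (2 + K)) ((2 + 2 * K) / (2 + 3 * K - K ^+ 2)) < cR ->
  cR * g ^+ 2 * kmax t N <= c1 -> c1 < 1 ->
  l2V t B e 2 n ^+ 2 + linfV B e 2 n ^+ 2 <=
    (1 + t n) * (gronwall_const t cR c1 gamma n / cR) * (2 + cR * c4 ^+ 2) *
    (kmax t N ^+ 4 * t n + (k 1%N)^-1 * y 1%N + V 1%N).
Proof.
move=> nN rK K1 Kmax; rewrite gt_max => /andP[cR1 cR2] c1g c11.
have tn : 0 < t n by have /andP[] : Jint T (t n) by apply: (partition_Jint part); nat_lia.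
have k1 : 0 < k 1%N by apply: (kstep_gt0 part); nat_lia.
have K17 : 0 < 2 + 3 * K - K ^+ 2.
  have s17 : Num.sqrt 17 ^+ 2 = 17 :> R by rewrite sqr_sqrtr.
  have s0 : 0 <= Num.sqrt 17 :> R by exact: sqrtr_ge0.
  have : 0 < (Num.sqrt 17 / 2 - (K - 3 / 2)) * (Num.sqrt 17 / 2 + (K - 3 / 2)).
    by apply: mulr_gt0; [lra | nra].
  nra.
have K20 : 0 < 2 + K by lra.
rewrite !ltr_pdivrMr// in cR1 cR2.
have cR0 : 0 < cR by rewrite -(pmulr_lgt0 _ K20); lra.
have cRge1 : 1 <= cR by nra.
pose beta := cR^-1.
have beta0 : 0 < beta by rewrite invr_gt0.
have bc : beta * cR = 1 by rewrite mulVf// gt_eqF.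
have th : 0 <= 1 - beta <= 1 - beta by rewrite lexx andbT subr_ge0 invf_le1.
have Kc : K ^+ 2 <= 4 * (1 - beta) * (1 + K).
  have := ler_wpM2l (ltW beta0) (ltW cR1).
  have := ler_wpM2l (ltW beta0) (ltW cR2).
  by rewrite !mulrA bc !mul1r; lra.
have step j : (2 <= j <= N)%N -> k j * s j <= 4 * (1 - beta) * k j.-1.
  by move=> jN; exact: (kstep_sstep_le part rK Kc jN).
have blam : beta^-1 <= cR by rewrite invrK.
have := @energy_estimate beta (1 - beta) cR c1 n nN beta0 blam th _ c1g c11.
rewrite subrr mulr0.
set E := expR _; set F := (_ + cR * _ * _ * _).
move=> est; have {}est m : (2 <= m <= n)%N -> V m <= E * F.
  move=> mn; have := est _ m mn; rewrite mul0r addr0; apply => j jn.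
  by apply: step; nat_lia.
set I := (kmax t N ^+ 4 * t n + _ + _).
have c10 : 0 <= c1.
  by apply: le_trans c1g; rewrite mulr_ge0 ?kmax_ge0// mulr_ge0 ?sqr_ge0 ?(ltW cR0).
have EC : E <= gronwall_const t cR c1 gamma n / cR.
  rewrite /gronwall_const -/E (_ : _ / cR = (1 - c1)^-1 * E); last first.
    by field; rewrite !gt_eqF ?subr_gt0.
  by rewrite ler_peMl ?expR_ge0// invf_ge1 ?subr_gt0//; lra.
have FI : F <= (2 + cR * c4 ^+ 2) * I.
  have W1 : k 2%N * s 2%N / 2 * W 1%N <= 2 * ((k 1%N)^-1 * y 1%N).
    have -> : 2 * ((k 1%N)^-1 * y 1%N) = 2 * k 1%N * W 1%N.
      by rewrite dbar_error1; field; rewrite gt_eqF.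
    apply: ler_wpM2r; first exact: sqr_ge0.
    have := step 2%N (_ : 2 <= 2 <= N)%N; move=> /(_ ltac:(nat_lia)) /=.
    by have := mulr_gt0 beta0 k1; lra.
  have k4 : cR * c4 ^+ 2 * kmax t n ^+ 4 * t n
      <= cR * c4 ^+ 2 * (kmax t N ^+ 4 * t n).
    rewrite -mulrA; apply: ler_wpM2l; first by rewrite mulr_ge0 ?sqr_ge0 ?(ltW cR0).
    by rewrite ler_pM2r// kmax4_le//; nat_lia.
  have y1 : 0 <= (k 1%N)^-1 * y 1%N by rewrite mulr_ge0 ?sqr_ge0 ?invr_ge0 ?(ltW k1).
  have V1 : 0 <= V 1%N by exact: sqr_ge0.
  have kt : 0 <= kmax t N ^+ 4 * t n by rewrite mulr_ge0 ?(ltW tn) ?exprn_ge0 ?kmax_ge0.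
  have cc : 0 <= cR * c4 ^+ 2 by rewrite mulr_ge0 ?sqr_ge0 ?(ltW cR0).
  have := mulr_ge0 cc y1; have := mulr_ge0 cc V1.
  by rewrite /F /I; lra.
have F0 : 0 <= F by apply: initial_energy_ge0 => //; exact: ltW.
have VQ m : (2 <= m <= n)%N ->
    V m <= gronwall_const t cR c1 gamma n / cR * (2 + cR * c4 ^+ 2) * I.
  move=> mn; apply: (le_trans (est m mn)); rewrite -mulrA.
  by apply: ler_pM; rewrite ?expR_ge0.
set Q := _ / _ * _ * I in VQ.
have Q0 : 0 <= Q by apply: le_trans (VQ n _); [exact: sqr_ge0|nat_lia].
rewrite -2!mulrA [X in _ <= _ * X]mulrA -/Q mulrDl mul1r addrC lerD//.
  by apply: bigmax_sqr_le => // j jn; split; [exact: normr_ge0|exact: VQ].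
rewrite l2V_sqr; last by nat_lia.
apply: (@le_trans _ _ ((\sum_(2 <= j < n.+1) k j) * Q)).
  rewrite mulr_suml big_nat [leRHS]big_nat; apply: ler_sum => j jn.
  apply: ler_wpM2l; last by apply: VQ; nat_lia.
  by apply/ltW/(kstep_gt0 part); nat_lia.
by apply: ler_wpM2r => //; apply: (sum_kstep_le part); nat_lia.
Qed.

Lemma sqrt2_bounds : 1 < (Num.sqrt 2 : R) < 71 / 50 /\ Num.sqrt 2 ^+ 2 = 2 :> R.
Proof.
have s2 : Num.sqrt 2 ^+ 2 = 2 :> R by rewrite sqr_sqrtr.
split=> //; have : 0 <= Num.sqrt 2 :> R by exact: sqrtr_ge0.
by move: (Num.sqrt 2) s2 => x x2 x0; apply/andP; split; nra.
Qed.

Lemma energy_below_sqrt2 (K c1 : R) n : (2 <= n <= N)%N ->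
  rmax t N <= K -> 1 < K -> K < Num.sqrt 2 + 1 ->
  a * g ^+ 2 * kmax t N <= c1 -> c1 < 1 ->
  forall m, (2 <= m <= n)%N ->
  V m + (\sum_(2 <= j < m.+1) k j * W j) / 10 <=
    expR (a / (1 - c1) * \sum_(2 <= j < n.+1) gamma (t j) ^+ 2 * k j) *
    (V 1%N + k 2%N / 2 * W 1%N + a * c4 ^+ 2 * kmax t n ^+ 4 * t n).
Proof.
move=> nN rK K1 K2 c1g c11 m mn.
have [/andP[s21 s22] _] := sqrt2_bounds.
have Kc : K ^+ 2 <= 4 * (9 / 20) * (1 + K).
  have : 0 <= (121 / 50 - K) * (K - 1) by apply: mulr_ge0; lra.
  lra.
have half0 : 0 < 1 / 2 :> R by lra.
have lam : (1 / 2)^-1 <= a by rewrite mul1r invrK; lra.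
have th : 0 <= (9 / 20 : R) <= 1 - 1 / 2 by apply/andP; split; lra.
have := energy_estimate nN half0 lam th _ c1g c11 mn.
rewrite (_ : 2 * (1 - 1 / 2 - 9 / 20) = 10^-1); last by field.
rewrite [10^-1 * _]mulrC => est; apply: (le_trans (est _)).
  by move=> j jn; apply: (kstep_sstep_le part rK Kc); nat_lia.
apply: ler_wpM2l; first exact: expR_ge0.
rewrite lerD2r lerD2l; apply: ler_wpM2r; first exact: sqr_ge0.
have /andP[s0 s1] : 0 <= s 2%N <= 1 by apply: (sstep_itv part); nat_lia.
have k0 : 0 <= k 2%N by apply/ltW/(kstep_gt0 part); nat_lia.
by rewrite ler_pM2r ?invr_gt0// ler_piMr.
Qed.

Lemma kstep2_dbar1 : k 2%N * W 1%N = k 2%N / k 1%N ^+ 2 * y 1%N.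
Proof. by rewrite dbar_error1 exprVn mulrA. Qed.

Lemma error_V_below_sqrt2 (K c1 : R) n : (2 <= n <= N)%N ->
  rmax t N <= K -> 1 < K -> K < Num.sqrt 2 + 1 ->
  a * g ^+ 2 * kmax t N <= c1 -> c1 < 1 ->
  l2HH t e 2 n ^+ 2 + linfV B e 2 n ^+ 2 <=
    11 * (gronwall_const t a c1 gamma n / a) * (1 + a * c4 ^+ 2) *
    (kmax t N ^+ 4 * t n + k 2%N / k 1%N ^+ 2 * y 1%N + V 1%N).
Proof.
move=> nN rK K1 K2 c1g c11.
have [/andP[s21 s22] _] := sqrt2_bounds.
have a0 : 0 < a by lra.
have := energy_below_sqrt2 nN rK K1 K2 c1g c11.
set E := expR _; set F := (_ + a * _ * _ * _) => est.
set I := (kmax t N ^+ 4 * t n + _ + _).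
have tn : 0 < t n by have /andP[] : Jint T (t n) by apply: (partition_Jint part); nat_lia.
have k2 : 0 < k 2%N by apply: (kstep_gt0 part); nat_lia.
have c10 : 0 <= c1.
  by apply: le_trans c1g; rewrite mulr_ge0 ?kmax_ge0// mulr_ge0 ?sqr_ge0 ?(ltW a0).
have EC : E <= gronwall_const t a c1 gamma n / a.
  rewrite /gronwall_const -/E (_ : _ / a = (1 - c1)^-1 * E); last first.
    by field; rewrite !gt_eqF ?subr_gt0.
  by rewrite ler_peMl ?expR_ge0// invf_ge1 ?subr_gt0//; lra.
have V1 : 0 <= V 1%N by exact: sqr_ge0.
have W1 : 0 <= k 2%N * W 1%N by rewrite mulr_ge0 ?sqr_ge0 ?(ltW k2).
have cc : 0 <= a * c4 ^+ 2 by rewrite mulr_ge0 ?sqr_ge0 ?(ltW a0).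
have k4 : a * c4 ^+ 2 * kmax t n ^+ 4 * t n <= a * c4 ^+ 2 * (kmax t N ^+ 4 * t n).
  rewrite -mulrA; apply: ler_wpM2l => //.
  by rewrite ler_pM2r// kmax4_le//; nat_lia.
have kt m : 0 <= kmax t m ^+ 4 * t n by rewrite mulr_ge0 ?(ltW tn) ?exprn_ge0 ?kmax_ge0.
have FI : F <= (1 + a * c4 ^+ 2) * I.
  have := mulr_ge0 cc V1; have := mulr_ge0 cc W1; have := kt N.
  by rewrite /F /I -kstep2_dbar1; lra.
have F0 : 0 <= F.
  rewrite /F; have := mulr_ge0 cc (kt n); rewrite !mulrA; lra.
have EF : E * F <= gronwall_const t a c1 gamma n / a * (1 + a * c4 ^+ 2) * I.
  by rewrite -mulrA; apply: ler_pM; rewrite ?expR_ge0.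
set Q := _ / _ * _ * I in EF.
have SW0 m : (m <= N)%N -> 0 <= \sum_(2 <= j < m.+1) k j * W j.
  move=> mN; rewrite big_nat; apply: sumr_ge0 => j jm.
  by rewrite mulr_ge0 ?sqr_ge0// ltW// (kstep_gt0 part)//; nat_lia.
have VQ m : (2 <= m <= n)%N -> V m <= Q.
  move=> mn; have := est m mn; have := SW0 m; move=> /(_ ltac:(nat_lia)); lra.
have Q0 : 0 <= Q by apply: le_trans (VQ n _); [exact: sqr_ge0|nat_lia].
have Vinf : linfV B e 2 n ^+ 2 <= Q.
  by apply: bigmax_sqr_le => // j jn; split; [exact: normr_ge0|exact: VQ].
have := l2HH_sqr_le nN; have := est n; move=> /(_ ltac:(nat_lia)).
have -> : 11 * (gronwall_const t a c1 gamma n / a) * (1 + a * c4 ^+ 2) * I = 11 * Q.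
  by rewrite /Q; ring.
have : 0 <= V n by exact: sqr_ge0.
lra.
Qed.

Lemma error_H_below_sqrt2 (K c1 c2 : R) n : (2 <= n <= N)%N ->
  rmax t N <= K -> 1 < K -> K < Num.sqrt 2 + 1 ->
  let c3 := (1 + K) ^+ 2 / (1 + 2 * K - K ^+ 2) in
  a * g ^+ 2 * kmax t N <= c1 -> c1 < 1 ->
  2 * c3 * g ^+ 2 * kmax t N <= c2 -> c2 < 1 ->
  linfH e 2 n ^+ 2 + l2V t B e 2 n ^+ 2 <=
    3 * expR (4 * c3 * g ^+ 2 * t n + 1) *
    (1 + 3 * c3 + 4 * c3 ^+ 2 * c4 ^+ 2 * t n ^+ 2 +
     20 * c3 * expR (a / (1 - c1) * (g ^+ 2 * t n)) * (1 + a * c4 ^+ 2 * t n ^+ 2)) *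
    (y 1%N + kmax t N * V 1%N + kmax t N * k 2%N / k 1%N ^+ 2 * y 1%N
     + kmax t N ^+ 4).
Proof.
move=> nN rK K1 K2 c3 c1g c11 c2g c21.
have [/andP[s21 s22] s2] := sqrt2_bounds.
have a0 : 0 < a by lra.
have K2' : K ^+ 2 < 1 + 2 * K.
  have : 0 < (Num.sqrt 2 + 1 - K) * (K - 1 + Num.sqrt 2) by apply: mulr_gt0; lra.
  move: s2; lra.
have est := value_estimate nN K1 K2' rK c2g c21.
have c30 : 0 < c3 by apply: divr_gt0; [apply: exprn_gt0|]; lra.
rewrite -/c3 in est; clearbody c3.
have nrg := energy_below_sqrt2 nN rK K1 K2 c1g c11.
set X := expR _ in est *.
set E1 := expR (_ * (g ^+ 2 * t n)).
set SW := \sum_(2 <= j < n.+1) k j * W j in est.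
set SV := fun m => \sum_(2 <= j < m.+1) k j * V j.
have tn : 0 < t n by have /andP[] : Jint T (t n) by apply: (partition_Jint part); nat_lia.
have k2 : 0 < k 2%N by apply: (kstep_gt0 part); nat_lia.
have V1 : 0 <= V 1%N by exact: sqr_ge0.
have W1 : 0 <= k 2%N * W 1%N by rewrite mulr_ge0 ?sqr_ge0 ?(ltW k2).
have y1 : 0 <= y 1%N by exact: sqr_ge0.
have kn0 := kmax_ge0 t n; have kN0 := kmax_ge0 t N.
have knN : kmax t n <= kmax t N by apply: kmax_le_seq; nat_lia.
have knt : kmax t n <= t n by apply: (kmax_le_time part); nat_lia.
have k4 : kmax t n ^+ 4 <= kmax t N ^+ 4 by apply: kmax4_le; nat_lia.
have kN4 : 0 <= kmax t N ^+ 4 by exact: exprn_ge0.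
have cc : 0 <= a * c4 ^+ 2 by rewrite mulr_ge0 ?sqr_ge0 ?(ltW a0).
pose P := kmax t N * V 1%N + kmax t N * (k 2%N * W 1%N)
  + a * c4 ^+ 2 * t n ^+ 2 * kmax t N ^+ 4.
have SWP : kmax t n * SW <= 10 * E1 * P.
  have EE1 : expR (a / (1 - c1) * \sum_(2 <= j < n.+1) gamma (t j) ^+ 2 * k j) <= E1.
    rewrite ler_expR; apply: ler_wpM2l; first by rewrite divr_ge0 ?(ltW a0)//; lra.
    apply: (@le_trans _ _ (g ^+ 2 * \sum_(2 <= j < n.+1) k j)).
      rewrite mulr_sumr big_nat [leRHS]big_nat; apply: ler_sum => j jn.
      have jN : (1 <= j <= N)%N by nat_lia.
      have /andP[g0 gg] := rate_itv jN.
      apply: ler_wpM2r; first by apply/ltW/(kstep_gt0 part).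
      by rewrite lerXn2r// nnegrE (le_trans g0).
    by apply: ler_wpM2l; [exact: sqr_ge0|apply: (sum_kstep_le part); nat_lia].
  have := nrg n; move=> /(_ ltac:(nat_lia)).
  set F := (_ + a * _ * _ * _) => nrgn.
  have F0 : 0 <= F.
    have : 0 <= a * c4 ^+ 2 * kmax t n ^+ 4 * t n.
      apply: mulr_ge0; last exact: ltW.
      by apply: mulr_ge0 => //; exact: exprn_ge0.
    by rewrite /F; lra.
  have Vn : 0 <= V n by exact: sqr_ge0.
  have EF := ler_wpM2r F0 EE1.
  have SWF : SW <= 10 * (E1 * F) by rewrite -/SW in nrgn; lra.
  apply: (le_trans (ler_wpM2l kn0 SWF)).
  have -> : kmax t n * (10 * (E1 * F)) = 10 * E1 * (kmax t n * F) by ring.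
  apply: ler_wpM2l; first by rewrite mulr_ge0 ?expR_ge0.
  have := ler_wpM2r V1 knN; have := ler_wpM2r W1 knN.
  have : a * c4 ^+ 2 * kmax t n ^+ 4 * t n * kmax t n <=
      a * c4 ^+ 2 * t n ^+ 2 * kmax t N ^+ 4.
    have -> : a * c4 ^+ 2 * kmax t n ^+ 4 * t n * kmax t n =
        a * c4 ^+ 2 * t n * (kmax t n * kmax t n ^+ 4) by ring.
    have -> : a * c4 ^+ 2 * t n ^+ 2 * kmax t N ^+ 4 =
        a * c4 ^+ 2 * t n * (t n * kmax t N ^+ 4) by ring.
    apply: ler_wpM2l; first by apply: mulr_ge0 => //; exact: ltW.
    by apply: ler_pM => //; exact: exprn_ge0.
  have := mulr_ge0 kN0 W1.
  by rewrite /F /P; lra.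
set I := (y 1%N + _ + _ + _).
set Q := (1 + 3 * c3 + _ + _).
have IE : I = y 1%N + kmax t N * V 1%N + kmax t N * (k 2%N * W 1%N) + kmax t N ^+ 4.
  by rewrite /I kstep2_dbar1 !mulrA.
have MQ : y 1%N + c3 * (3 * y 1%N + 4 * c3 * c4 ^+ 2 * t n ^+ 2 * kmax t n ^+ 4
    + 2 * kmax t n * SW) <= Q * I.
  have A1 := mulr_ge0 kN0 V1; have A2 := mulr_ge0 kN0 W1.
  have h4 : y 1%N <= I by rewrite IE; lra.
  have I0 : 0 <= I by exact: le_trans h4.
  have h1 : 3 * c3 * y 1%N <= 3 * c3 * I.
    by apply: (ler_wpM2l _ h4); rewrite mulr_ge0 ?(ltW c30).
  have h2 : 4 * c3 ^+ 2 * c4 ^+ 2 * t n ^+ 2 * kmax t n ^+ 4 <=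
      4 * c3 ^+ 2 * c4 ^+ 2 * t n ^+ 2 * I.
    have sqE x : 4 * c3 ^+ 2 * c4 ^+ 2 * t n ^+ 2 * x = 4 * (c3 * c4 * t n) ^+ 2 * x.
      by ring.
    rewrite !sqE; apply: ler_wpM2l; first by rewrite mulr_ge0 ?sqr_ge0.
    by rewrite IE; lra.
  have at0 : 0 <= a * c4 ^+ 2 * t n ^+ 2 by apply: mulr_ge0 => //; exact: sqr_ge0.
  have PI : P <= (1 + a * c4 ^+ 2 * t n ^+ 2) * I.
    rewrite IE /P; move: (_ * t n ^+ 2) at0 => w w0.
    have := mulr_ge0 w0 y1; have := mulr_ge0 w0 A1; have := mulr_ge0 w0 A2.
    lra.
  have h3 : 2 * c3 * (kmax t n * SW) <= 20 * c3 * E1 * ((1 + a * c4 ^+ 2 * t n ^+ 2) * I).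
    have -> : 20 * c3 * E1 * ((1 + a * c4 ^+ 2 * t n ^+ 2) * I) =
        2 * c3 * (10 * E1 * ((1 + a * c4 ^+ 2 * t n ^+ 2) * I)) by ring.
    apply: ler_wpM2l; first by rewrite mulr_ge0 ?(ltW c30).
    apply: (le_trans SWP); apply: (ler_wpM2l _ PI).
    by rewrite mulr_ge0 ?expR_ge0.
  by rewrite /Q; lra.
have X0 : 0 <= X by exact: expR_ge0.
have main m : (2 <= m <= n)%N -> y m + SV m / 2 <= X * (Q * I).
  by move=> mn; apply: (le_trans (est m mn)); exact: ler_wpM2l.
have SV0 m : (m <= N)%N -> 0 <= SV m.
  move=> mN; rewrite /SV big_nat; apply: sumr_ge0 => j jm.
  by rewrite mulr_ge0 ?sqr_ge0// ltW// (kstep_gt0 part)//; nat_lia.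
have yQ m : (2 <= m <= n)%N -> y m <= X * (Q * I).
  move=> mn; have := main m mn; have := SV0 m; move=> /(_ ltac:(nat_lia)); lra.
have XQ0 : 0 <= X * (Q * I) by apply: le_trans (yQ n _); [exact: sqr_ge0|nat_lia].
have Hinf : linfH e 2 n ^+ 2 <= X * (Q * I).
  by apply: bigmax_sqr_le => // j jn; split; [exact: normr_ge0|exact: yQ].
rewrite l2V_sqr -/(SV n); last by nat_lia.
have := main n; move=> /(_ ltac:(nat_lia)).
have : 0 <= y n by exact: sqr_ge0.
by rewrite -!mulrA; lra.
Qed.

End ErrorEquation.

Theorem theorem5p1 (R : realType) :
  exists (Ci Cii : R -> R -> R -> R -> R)
         (Ciii : R -> R -> R -> R -> R -> R -> R -> R -> R),
  forall (H : completeNormedModType R) (dot : {dot H for idfun})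
    (A B : operator H) (T : R) (f : R -> H -> H) (gamma : R -> R)
    (u0 : H) (u : R -> H) (N : nat) (t : nat -> R) (U : nat -> H) (c4 : R),
  hilbert_norm dot ->
  self_adjoint dot A ->
  positive_definite dot A ->
  is_sqrt_operator dot A B ->
  lipschitz_rate T gamma ->
  parabolic_solution A T f u0 u ->
  locally_lipschitz B T u gamma f ->
  (2 <= N)%N ->
  partition_of t T N ->
  bdf2_solution t A N f u0 U ->
  (forall n, (2 <= n <= N)%N -> tube B (u (t n)) (U n)) ->
  (forall n, (2 <= n <= N)%N ->
     `|consistency_error t A f u n| <= c4 * kstep t n ^+ 2) ->
  let e := fun n => u (t n) - U n in
  let g := gamma_max T gamma in
  let k := kstep t in
  let km := kmax t N in
  let a := 4 + 2 * Num.sqrt 2 : R in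
  forall n, (2 <= n <= N)%N ->
  [/\
    (* (i) *)
    forall K cR c1 : R,
      rmax t N <= K -> 1 < K -> K < (3 + Num.sqrt 17) / 2 ->
      Num.max ((2 + 2 * K) / (2 + K)) ((2 + 2 * K) / (2 + 3 * K - K ^+ 2))
        < cR ->
      cR * g ^+ 2 * km <= c1 -> c1 < 1 ->
      l2V t B e 2 n ^+ 2 + linfV B e 2 n ^+ 2 <=
        Ci (gronwall_const t cR c1 gamma n) (t n) c4 cR *
        (km ^+ 4 * t n + (k 1%N)^-1 * `|e 1%N| ^+ 2 + normV B (e 1%N) ^+ 2),
    (* (ii) *)
    forall K c1 : R,
      rmax t N <= K -> 1 < K -> K < Num.sqrt 2 + 1 ->
      a * g ^+ 2 * km <= c1 -> c1 < 1 ->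
      l2HH t e 2 n ^+ 2 + linfV B e 2 n ^+ 2 <=
        Cii (gronwall_const t a c1 gamma n) (t n) c4 (rstep t 2) *
        (km ^+ 4 * t n + k 2%N / k 1%N ^+ 2 * `|e 1%N| ^+ 2
         + normV B (e 1%N) ^+ 2)
    & (* (iii) *)
    forall K c1 c2 : R,
      rmax t N <= K -> 1 < K -> K < Num.sqrt 2 + 1 ->
      let c3 := (1 + K) ^+ 2 / (1 + 2 * K - K ^+ 2) in
      a * g ^+ 2 * km <= c1 -> c1 < 1 ->
      2 * c3 * g ^+ 2 * km <= c2 -> c2 < 1 ->
      linfH e 2 n ^+ 2 + l2V t B e 2 n ^+ 2 <=
        Ciii g c1 c2 c3 c4 K (t n) (Phi t n) *
        (`|e 1%N| ^+ 2 + km * normV B (e 1%N) ^+ 2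
         + km * k 2%N / k 1%N ^+ 2 * `|e 1%N| ^+ 2 + km ^+ 4)].
Proof.
exists (fun C s c4 cR => (1 + s) * (C / cR) * (2 + cR * c4 ^+ 2)).
exists (fun C _ c4 _ => let a := 4 + 2 * Num.sqrt 2 in
  11 * (C / a) * (1 + a * c4 ^+ 2)).
exists (fun g c1 _ c3 c4 _ s _ => let a := 4 + 2 * Num.sqrt 2 in
  3 * expR (4 * c3 * g ^+ 2 * s + 1) *
  (1 + 3 * c3 + 4 * c3 ^+ 2 * c4 ^+ 2 * s ^+ 2 +
   20 * c3 * expR (a / (1 - c1) * (g ^+ 2 * s)) * (1 + a * c4 ^+ 2 * s ^+ 2))).
move=> H dot A B T f gamma u0 u N t U c4 dot_norm Asa _ AB rate sol lip _ part
  scheme UV cons e g k km a n nN; split.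
- move=> K cR c1 rK K1 K2 cRK c1g c11.
  exact: (error_V_below_R1 dot_norm Asa AB rate sol lip part scheme UV cons
            nN rK K1 K2 cRK c1g c11).
- move=> K c1 rK K1 K2 c1g c11.
  exact: (error_V_below_sqrt2 dot_norm Asa AB rate sol lip part scheme UV cons
            nN rK K1 K2 c1g c11).
move=> K c1 c2 rK K1 K2 c3 c1g c11 c2g c21.
exact: (error_H_below_sqrt2 dot_norm Asa AB rate sol lip part scheme UV cons
          nN rK K1 K2 c1g c11 c2g c21).
Qed.
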